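(* Let $\mathfrak{g}$ be a real Lie algebra of dimension $2n$, identified as a vector space with $\mathbb{R}^{2n}$ with canonical basis $\{e_1,\ldots,e_{2n}\}$. Let $U\subset \mathrm{GL}(2n,\mathbb{R})$ be a set of representatives of $\mathfrak{P}\Omega(\mathfrak{g})$. Then for every $\omega\in\Omega(\mathfrak{g})$ there exist $k>0$, $\phi\in\mathrm{Aut}(\mathfrak{g})$ and $h\in U$ such that $\{\phi h e_1,\ldots,\phi h e_{2n}\}$ is a symplectic basis with respect to $k\omega$.
   Context: $\Omega(\mathfrak{g})$ denotes the set of nondegenerate alternating bilinear forms ($2$-forms) on the vector space $\mathfrak{g}$ (not necessarily closed). The group $\mathrm{GL}(2n,\mathbb{R})$ acts on $\Omega(\mathfrak{g})$ by $g.\omega(\cdot,\cdot)=\omega(g^{-1}(\cdot),g^{-1}(\cdot))$. $\mathrm{Aut}(\mathfrak{g})$ is the group of Lie algebra automorphisms of $\mathfrak{g}$, $\mathbb{R}^\times=\mathbb{R}\setminus\{0\}$, and $\mathbb{R}^\times\mathrm{Aut}(\mathfrak{g})=\{c\phi \mid \phi\in\mathrm{Aut}(\mathfrak{g}),\ c\in\mathbb{R}^\times\}$, a subgroup of $\mathrm{GL}(2n,\mathbb{R})$. For $\omega\in\Omega(\mathfrak{g})$, $[\omega]$ denotes the orbit $(\mathbb{R}^\times\mathrm{Aut}(\mathfrak{g})).\omega$, and $\mathfrak{P}\Omega(\mathfrak{g})=\{[\omega]\mid\omega\in\Omega(\mathfrak{g})\}$ is the orbit space (the moduli space of left-invariant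 nondegenerate $2$-forms). Let $\{\varepsilon^1,\ldots,\varepsilon^{2n}\}$ be the basis dual to $\{e_1,\ldots,e_{2n}\}$ and let $\omega_0=\varepsilon^1\wedge\varepsilon^{n+1}+\cdots+\varepsilon^n\wedge\varepsilon^{2n}$ be the canonical symplectic form. A subset $U\subset\mathrm{GL}(2n,\mathbb{R})$ is called a set of representatives of $\mathfrak{P}\Omega(\mathfrak{g})$ if $\mathfrak{P}\Omega(\mathfrak{g})=\{[h.\omega_0]\mid h\in U\}$. A basis $\{x_1,\ldots,x_{2n}\}$ is symplectic with respect to a $2$-form $\omega$ if for all $i<j$ one has $\omega(x_i,x_j)=1$ when $j=i+n$ and $\omega(x_i,x_j)=0$ otherwise. *)

(* Defs.v *)
From HB Require Import structures.
From mathcomp Require Import all_boot all_order all_algebra.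
From mathcomp Require Import boolp classical_sets reals.

Set Implicit Arguments.
Unset Strict Implicit.
Unset Printing Implicit Defensive.

Import Order.TTheory GRing.Theory Num.Theory.

Local Open Scope classical_set_scope.
Local Open Scope ring_scope.

(* R^m is the space of column vectors 'cV[R]_m, on which GL(m, R) acts on the
   left by g *m x; the Lie algebra g is R^(n + n) equipped with a bracket. *)

Definition is_lie_bracket (R : realType) (m : nat)
    (br : 'cV[R]_m -> 'cV[R]_m -> 'cV[R]_m) : Prop :=
  [/\ bilinear_for *:%R *:%R br,
      forall x, br x x = 0 &
      forall x y z, br x (br y z) + br y (br z x) + br z (br x y) = 0].

Definition GL (R : realType) (m : nat) : set 'M[R]_m := [set` unitmx].

Definition Aut (R : realType) (m : nat)
    (br : 'cV[R]_m -> 'cV[R]_m -> 'cV[R]_m) : set 'M[R]_m :=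
  [set phi | GL phi /\ forall x y, phi *m br x y = br (phi *m x) (phi *m y)].

Definition RAut (R : realType) (m : nat)
    (br : 'cV[R]_m -> 'cV[R]_m -> 'cV[R]_m) : set 'M[R]_m :=
  [set c *: phi | c in [set c : R | c != 0] & phi in Aut br].

Definition Omega (R : realType) (m : nat) : set ('cV[R]_m -> 'cV[R]_m -> R) :=
  [set w | [/\ bilinear_for *%R *%R w,
               forall x, w x x = 0 &
               forall x, (forall y, w x y = 0) -> x = 0]].

Definition act (R : realType) (m : nat) (g : 'M[R]_m)
    (w : 'cV[R]_m -> 'cV[R]_m -> R) : 'cV[R]_m -> 'cV[R]_m -> R :=
  fun x y => w (invmx g *m x) (invmx g *m y).

Definition orbit (R : realType) (m : nat)
    (br : 'cV[R]_m -> 'cV[R]_m -> 'cV[R]_m) (w : 'cV[R]_m -> 'cV[R]_m -> R) :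
    set ('cV[R]_m -> 'cV[R]_m -> R) :=
  [set act g w | g in RAut br].

Definition moduli (R : realType) (m : nat)
    (br : 'cV[R]_m -> 'cV[R]_m -> 'cV[R]_m) :
    set (set ('cV[R]_m -> 'cV[R]_m -> R)) :=
  [set orbit br w | w in @Omega R m].

Definition stdbasis (R : realType) (m : nat) (i : 'I_m) : 'cV[R]_m :=
  delta_mx i 0.

Definition dualbasis (R : realType) (m : nat) (i : 'I_m) : 'cV[R]_m -> R :=
  fun x => x i 0.

(* Normalized without a factor 1/2, so that (wedge a b) (x, y) = 1 on vectors
   x, y dual to a, b. *)
Definition wedge (R : realType) (m : nat) (a b : 'cV[R]_m -> R) :
    'cV[R]_m -> 'cV[R]_m -> R :=
  fun x y => a x * b y - a y * b x.

Definition omega0 (R : realType) (n : nat) :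
    'cV[R]_(n + n) -> 'cV[R]_(n + n) -> R :=
  fun x y => \sum_(i < n)
    wedge (dualbasis (lshift n i)) (dualbasis (rshift n i)) x y.

Definition is_set_of_representatives (R : realType) (n : nat)
    (br : 'cV[R]_(n + n) -> 'cV[R]_(n + n) -> 'cV[R]_(n + n))
    (U : set 'M[R]_(n + n)) : Prop :=
  U `<=` @GL R (n + n) /\
  moduli br = [set orbit br (act h (@omega0 R n)) | h in U].

Definition is_symplectic_basis (R : realType) (n : nat)
    (w : 'cV[R]_(n + n) -> 'cV[R]_(n + n) -> R)
    (x : 'I_(n + n) -> 'cV[R]_(n + n)) : Prop :=
  basis_of fullv [tuple x i | i < n + n] /\
  forall i j : 'I_(n + n), (i < j)%N ->
    w (x i) (x j) = if j == (i + n)%N :> nat then 1 else 0.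

(* Main.v *)
(* Since U represents the moduli space, w lies in the orbit of some h.omega0, that
   is w = (c phi h).omega0 with c nonzero and phi an automorphism.  The scalar c
   acts on 2-forms by c^-2, so c^2 w = (phi h).omega0, for which the image under
   phi h of the canonical basis is symplectic. *)

Require Import Defs.
From HB Require Import structures.
From mathcomp Require Import all_boot all_order all_algebra.
From mathcomp Require Import boolp classical_sets reals.
From mathcomp Require Import zify ring.

Set Implicit Arguments.
Unset Strict Implicit.
Unset Printing Implicit Defensive.

Import Order.TTheory GRing.Theory Num.Theory.

Local Open Scope classical_set_scope.
Local Open Scope ring_scope.

Lemma act1 (R : realType) (m : nat) (w : 'cV[R]_m -> 'cV[R]_m -> R) :
  act 1%:M w = w.
Proof.
by apply/funext => x; apply/funext => y; rewrite /act invmx1 !mul1mx.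
Qed.

Lemma orbit_refl (R : realType) (m : nat)
    (br : 'cV[R]_m -> 'cV[R]_m -> 'cV[R]_m) (w : 'cV[R]_m -> 'cV[R]_m -> R) :
  Defs.orbit br w w.
Proof.
exists 1%:M; last exact: act1.
exists 1 => /=; first exact: oner_neq0.
exists 1%:M; last by rewrite scale1r.
by split=> [|x y]; rewrite ?mul1mx // /GL /= unitmx1.
Qed.

Lemma omega0Z (R : realType) (n : nat) (c : R) (x y : 'cV[R]_(n + n)) :
  omega0 (c *: x) (c *: y) = c ^+ 2 * omega0 x y.
Proof.
rewrite /omega0 mulr_sumr; apply: eq_bigr => i _.
by rewrite /wedge /dualbasis !mxE; ring.
Qed.

Lemma omega0_stdbasis (R : realType) (n : nat) (i j : 'I_(n + n)) :
  (i < j)%N ->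
  omega0 (stdbasis R i) (stdbasis R j) =
    if j == (i + n)%N :> nat then 1 else 0.
Proof.
rewrite /omega0 /wedge /dualbasis /stdbasis.
(* Split by the half in which each index lies. If both lie in the same half, one factor of every
   product in the wedges vanishes; if [i] is in the first half and [j] in the second, only the
   summand [k = a] can survive; the remaining case contradicts [i < j]. *)
case: (split_ordP i) => a ->; case: (split_ordP j) => b -> /= ltij.
- rewrite ifF; last by have := ltn_ord b; lia.
  by apply: big1 => k _; rewrite !mxE !eq_rlshift !mulr0 subrr.
- rewrite addnC eqn_add2r (bigD1 a) //= big1 => [|k neka].
    rewrite !mxE !eq_lrshift !eqxx eq_rshift !mul0r subr0 addr0 !andbT mul1r.
    by rewrite eq_sym -val_eqE /=; case: (_ == _).
  by rewrite !mxE eq_lshift (negPf neka) eq_lrshift !mul0r subrr.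
- by have := ltn_ord b; lia.
- rewrite ifF; last by have := ltn_ord b; lia.
  by apply: big1 => k _; rewrite !mxE !eq_lrshift !mul0r subrr.
Qed.

(** There are as many vectors as the dimension, so freeness suffices. Injectivity of [g] carries a
    linear relation back to the standard basis, where the coordinate [i] reads off the coefficient
    [k i]. *)
Lemma unitmx_basis (R : realType) (m : nat) (g : 'M[R]_m) :
  g \in unitmx -> basis_of fullv [tuple g *m stdbasis R i | i < m].
Proof.
move=> gU; have dimE : \dim {:'cV[R]_m} = m by rewrite dimvf /dim /= muln1.
rewrite basisEfree subvf dimE size_tuple leqnn !andbT.
apply/freeP => k sum0 i.
have {}sum0 : \sum_j k j *: stdbasis R j = 0.
  apply: (can_inj (mulKmx gU)); rewrite mulmx0 mulmx_sumr -[RHS]sum0.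
  by apply: eq_bigr => j _; rewrite -tnth_nth tnth_mktuple scalemxAr.
have := congr1 (fun v : 'cV[R]_m => v i 0) sum0.
rewrite /= summxE (bigD1 i) //= big1 => [|j neji].
  by rewrite !mxE !eqxx mulr1 addr0.
by rewrite !mxE eq_sym (negPf neji) mulr0.
Qed.

Theorem theorem3p5 (R : realType) (n : nat)
    (br : 'cV[R]_(n + n) -> 'cV[R]_(n + n) -> 'cV[R]_(n + n))
    (hbr : is_lie_bracket br)
    (U : set 'M[R]_(n + n)) (hU : is_set_of_representatives br U)
    (w : 'cV[R]_(n + n) -> 'cV[R]_(n + n) -> R) (hw : @Omega R (n + n) w) :
  exists (k : R) (phi h : 'M[R]_(n + n)),
    [/\ 0 < k, Aut br phi, U h &
        is_symplectic_basis (fun x y => k * w x y)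
          (fun i => phi *m h *m stdbasis R i)].
Proof.
have [subU modU] := hU.
have : moduli br (Defs.orbit br w) by exists w.
rewrite modU => -[h Uh orbE].
(* The two orbits are equal as sets and [w] lies in its own, so [w] lies in that of
   [act h omega0]. *)
have : Defs.orbit br (act h (@omega0 R n)) w by rewrite orbE; exact: orbit_refl.
case=> _ [c /= c0 [phi phiA <-]] wE.
have hG : h \in unitmx by exact: subU.
have phiG : phi \in unitmx by case: phiA.
exists (c ^+ 2), phi, h; split=> //; first by rewrite exprn_even_gt0.
split=> [|i j ltij]; first by apply: unitmx_basis; rewrite unitmx_mul phiG.
(* Undoing the action of [c *: phi] and then of [h] on the candidate basis leaves the standard basis
   scaled by [c^-1]; the resulting factor [c^-2] cancels against [k = c ^+ 2]. *)
have pull x : invmx h *m (invmx (c *: phi) *m (phi *m h *m x)) = c^-1 *: x.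
  rewrite invmxZ ?unitmxZ ?unitfE // -!scalemxAl -!mulmxA.
  by rewrite mulKmx // -scalemxAr mulKmx.
rewrite -wE /act !pull omega0Z mulrA -exprMn divff // expr1n mul1r.
exact: omega0_stdbasis.
Qed.
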